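(* Let $(y_n)_{n\ge1}$ be a nondecreasing sequence of positive integers with output sequence $W(n)$, and set $y_0=0$. Then for every $n\ge1$, $$\prod_{k=0}^{n-1}(1+y_{k+1}-y_k)\le W(n)\le\prod_{k=1}^{n}(1+y_k).$$
   Context: For a nondecreasing sequence $(y_n)_{n\ge1}$ of positive integers and a positive integer $n$, an $n$-tuple $(x_1,\dots,x_n)$ of nonnegative integers is valid if $x_1\le y_n$ and $x_{j+1}\le\min(x_j,y_{n-j})$ for $1\le j\le n-1$. The output sequence $W(n)$ is the number of valid $n$-tuples, i.e. $W(n)=\sum_{k\ge0}A(n,k)$ where $A(n,k)$ is the number of valid $n$-tuples with $x_1=k$. *)

(* Defs.v *)
From mathcomp Require Import all_boot.
Set Implicit Arguments.
Unset Strict Implicit.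
Unset Printing Implicit Defensive.

(* Sequences (y_n)_(n >= 1) are functions nat -> nat; for n >= 1 the value y 0 *)
(* plays no role here. Tuples are 0-indexed, so x_j is nth 0 x j.-1, and the   *)
(* quantified j ranges over 1 <= j <= n - 1.                                   *)
Definition valid (y : nat -> nat) (n : nat) (x : n.-tuple nat) : bool :=
  (nth 0 x 0 <= y n) &&
  [forall j : 'I_n, (0 < j) ==> (nth 0 x j <= minn (nth 0 x j.-1) (y (n - j)))].

(* The entries of a valid n-tuple are at most y n, so it is enough to count in *)
(* the finite type of tuples over {0, ..., y n}; see outputP.                  *)
Definition output (y : nat -> nat) (n : nat) : nat :=
  #|[set x : n.-tuple 'I_(y n).+1 | valid y (map_tuple val x)]|.

Lemma valid_bounded (y : nat -> nat) (n : nat) (x : n.-tuple nat) :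
  valid y x -> all (fun v => v <= y n) x.
Proof.
move=> /andP[x0 /forallP xS]; apply/(all_nthP 0) => i; rewrite size_tuple.
elim: i => [//|i IHi] ltin; have := xS (Ordinal ltin) => /= /leq_trans.
by apply; rewrite geq_min IHi // ltnW.
Qed.

Lemma outputP (y : nat -> nat) (n : nat) (s : seq (n.-tuple nat)) :
  uniq s -> (forall x, (x \in s) = valid y x) -> output y n = size s.
Proof.
move=> us sP; rewrite /output cardE.
set e := enum _; pose f (x : n.-tuple 'I_(y n).+1) := map_tuple val x.
have f_inj : injective f.
  by move=> a b /(congr1 val) /= /(inj_map val_inj) /val_inj.
rewrite -(size_map f); apply/perm_size/uniq_perm => //.
  by rewrite map_inj_uniq // enum_uniq.
move=> x; rewrite sP; apply/mapP/idP => [[a]|vx].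
  by rewrite mem_enum inE => va ->.
have fK : f (map_tuple (@inord (y n)) x) = x.
  apply/val_inj; rewrite /= -map_comp -[RHS]map_id; apply/eq_in_map => v xv /=.
  by rewrite inordK // ltnS; apply: (allP (valid_bounded vx)).
by exists (map_tuple (@inord (y n)) x); rewrite ?fK // mem_enum inE -/(f _) fK.
Qed.

(* Main.v *)
Require Import Defs.
From mathcomp Require Import all_boot.

(* Valid tuples satisfy [x_j <= y_(n-j+1)], so they lie in a box counted by the *)
(* upper bound. Conversely, every tuple with [y_(n-j) <= x_j <= y_(n-j+1)] is   *)
(* valid, because then [x_(j+1) <= y_(n-j) <= x_j]; this smaller box is counted *)
(* by the lower bound.                                                          *)

(** Both boxes are instances of [card_ord_box], so each bound becomes an inclusion between sets of
    tuples over ['I_(y n).+1]. *)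

Lemma card_tuple_box (T : finType) (n : nat) (F : 'I_n -> pred T) :
  #|[set x : n.-tuple T | [forall i, tnth x i \in F i]]| = \prod_(i < n) #|F i|.
Proof.
pose f (x : n.-tuple T) : {ffun 'I_n -> T} := [ffun i => tnth x i].
have f_inj : injective f.
  by move=> a b /ffunP fab; apply: eq_from_tnth => i; have := fab i; rewrite !ffunE.
rewrite -(card_imset _ f_inj).
transitivity #|family F|; last by rewrite card_family foldrE big_image.
apply: eq_card => g; apply/imsetP/familyP => [[x]|gF].
  by rewrite inE => /forallP xF -> i; rewrite ffunE.
exists [tuple g i | i < n]; last by apply/ffunP => i; rewrite ffunE tnth_mktuple.
by rewrite inE; apply/forallP => i; rewrite tnth_mktuple.
Qed.

Lemma card_ord_interval (N a b : nat) : b < N ->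
  #|[pred v : 'I_N | a <= v <= b]| = b.+1 - a.
Proof.
move=> ltbN; rewrite -sum1_card -(big_mkord (fun v => a <= v <= b) (fun=> 1)).
(* The right side becomes a sum of ones over [a <= v < b.+1], then widened to [[0, N)] with both
   bounds as filters. *)
rewrite -[RHS]muln1 -sum_nat_const_nat [RHS](big_nat_widenl _ 0) //.
by rewrite [RHS](big_nat_widen _ _ N).
Qed.

(** The index is reversed because the bounds of a valid tuple run backwards through [y]. The
    hypothesis keeps ['I_N] from truncating an interval. *)
Lemma card_ord_box (N n : nat) (a b : nat -> nat) :
  (forall k, k < n -> b k < N) ->
  #|[set x : n.-tuple 'I_N | [forall i : 'I_n,
       a (n - i.+1) <= tnth x i <= b (n - i.+1)]]|
  = \prod_(0 <= k < n) ((b k).+1 - a k).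
Proof.
move=> ltbN.
rewrite (card_tuple_box _ _
  (fun i => [pred v : 'I_N | a (n - i.+1) <= v <= b (n - i.+1)])).
rewrite big_mkord [RHS](reindex_inj rev_ord_inj); apply: eq_bigr => i _.
by rewrite card_ord_interval // ltbN // ltn_subrL (leq_ltn_trans _ (ltn_ord i)).
Qed.

Theorem theorem6p3 (y : nat -> nat)
    (y0 : y 0 = 0)
    (y_pos : forall n, 1 <= n -> 0 < y n)
    (y_nondecr : forall m n, 1 <= m -> m <= n -> y m <= y n)
    (n : nat) (n_ge1 : 1 <= n) :
  \prod_(0 <= k < n) (1 + y k.+1 - y k) <= output y n
    <= \prod_(1 <= k < n.+1) (1 + y k).
Proof.
have ltyN k : k < n -> y k.+1 < (y n).+1 by move=> ltkn; apply: y_nondecr.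
have nthE (x : n.-tuple 'I_(y n).+1) (i : 'I_n) :
    nth 0 (map_tuple val x) i = tnth x i.
  by rewrite -tnth_nth tnth_map.
apply/andP; split.
- rewrite -(card_ord_box _ _ y (fun k => y k.+1) ltyN).
  apply/subset_leq_card/subsetP => x; rewrite !inE => /forallP xB.
  have {}xB (i : 'I_n) : y (n - i.+1) <= nth 0 (map_tuple val x) i <= y (n - i).
    by rewrite nthE; have := xB i; rewrite subnSK.
  apply/andP; split.
    by have := xB (Ordinal n_ge1); rewrite /= subn0 => /andP[].
  apply/forallP => -[[|j] ltjn] //=; rewrite leq_min.
  (* Consecutive intervals share the endpoint [y (n - j.+1)]: it bounds entry [j.+1] above and entry
     [j] below. *)
  have /andP[_ xj] := xB (Ordinal ltjn).
  have /andP[xj' _] := xB (Ordinal (ltnW ltjn)).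
  by rewrite [X in _ && X]xj andbT; apply: leq_trans xj'.
- have -> : \prod_(1 <= k < n.+1) (1 + y k)
      = \prod_(0 <= k < n) ((y k.+1).+1 - 0).
    by rewrite big_add1; apply: eq_bigr => k _; rewrite subn0.
  rewrite -(card_ord_box _ _ (fun=> 0) (fun k => y k.+1) ltyN).
  apply/subset_leq_card/subsetP => x; rewrite !inE => /andP[x0 /forallP xS].
  apply/forallP => i; rewrite subnSK //= -nthE.
  (* Entry 0 is bounded by the first conjunct of [valid], later entries by the second argument of
     [minn]. *)
  case: i => -[|j] ltjn; first by rewrite subn0.
  by have := xS (Ordinal ltjn); rewrite /= leq_min => /andP[].
Qed.
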